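(* For each positive integer $k$, there is a connected chordal graph $H_k$ such that $\mathrm{mp}(H_k)=9k$ and $\gamma_b(H_k)=10k$.
   Context: All graphs are finite, simple and undirected; $d(u,v)$ is the shortest-path distance and $\mathrm{diam}(G)$ the diameter. A graph is chordal if every cycle on four or more vertices has a chord. For $v\in V(G)$ and integer $r\ge 0$, $N_r[v]=\{u\in V(G): d(u,v)\le r\}$. A broadcast on $G$ is a function $f:V(G)\to\{0,1,\dots,\mathrm{diam}(G)\}$; it is dominating if for every $u\in V(G)$ there is $v\in V(G)$ (possibly $v=u$) with $f(v)>0$ and $d(u,v)\le f(v)$. Its cost is $\sum_{v} f(v)$, and $\gamma_b(G)$ is the minimum cost of a dominating broadcast on $G$. A multipacking of $G$ is a set $M\subseteq V(G)$ such that $|N_r[v]\cap M|\le r$ for every $v\in V(G)$ and every integer $r\ge 1$; $\mathrm{mp}(G)$ is the maximum size of a multipacking of $G$. *)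

(* Defs.v *)
From mathcomp Require Import all_boot.

Set Implicit Arguments.
Unset Strict Implicit.
Unset Printing Implicit Defensive.

Record sgraph := SGraph {
  vertex :> finType;
  adj : rel vertex;
  adj_sym : symmetric adj;
  adj_irr : irreflexive adj }.

Section Graph.
Variable G : sgraph.

Definition connected : Prop :=
  0 < #|G| /\ forall u v : G, connect (@adj G) u v.

(* [ucycle] means that [c] is closed and without repeated vertices.  A chord
   joins two vertices of [c] that are not consecutive in the cyclic order. *)
Definition chordal : Prop :=
  forall c : seq G, ucycle (@adj G) c -> 4 <= size c ->
    exists x y : G, [/\ x \in c, y \in c, adj x y, y != next c x & x != next c y].

Definition walk_of_length (n : nat) (u v : G) : bool :=
  [exists p : n.-tuple G, path (@adj G) u p && (last u p == v)].

(* Least length of a walk from [u] to [v].  A shortest path has fewer than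
   [#|G|] edges, so the search is complete; the value is [#|G|] exactly when
   [v] is not reachable from [u]. *)
Definition dist (u v : G) : nat :=
  find (fun n => walk_of_length n u v) (iota 0 #|G|).

(* Only meaningful when [G] is connected. *)
Definition diam : nat := \max_(u : G) \max_(v : G) dist u v.

(* The [connect] conjunct excludes unreachable vertices, for which [dist] has
   the conventional finite value [#|G|]. *)
Definition cball (r : nat) (v : G) : {set G} :=
  [set u | connect (@adj G) u v && (dist u v <= r)].

Definition broadcast : Type := {ffun G -> 'I_diam.+1}.

Definition dominating (f : broadcast) : Prop :=
  forall u : G, exists v : G, 0 < f v /\ u \in cball (f v) v.

Definition cost (f : broadcast) : nat := \sum_(v : G) f v.

(* A relation rather than a function, because the one-vertex graph has no
   dominating broadcast: its diameter is 0. *)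
Definition is_broadcast_number (m : nat) : Prop :=
  (exists f : broadcast, dominating f /\ cost f = m) /\
  (forall f : broadcast, dominating f -> m <= cost f).

Definition multipacking (M : {set G}) : Prop :=
  forall (v : G) (r : nat), 1 <= r -> #|cball r v :&: M| <= r.

Definition is_multipacking_number (m : nat) : Prop :=
  (exists M : {set G}, multipacking M /\ #|M| = m) /\
  (forall M : {set G}, multipacking M -> #|M| <= m).

End Graph.

(* Main.v *)
Require Import Defs.
From mathcomp Require Import all_boot.
From mathcomp Require Import zify.

(** The graph is a chain of [3k] blocks, each a 3-sun (ears [a], [b], [c] and
    triangle [x], [y], [z]) followed by a path on six vertices; [a] is joined to
    the path of the preceding block and [c] to the path of its own.  Along the
    chain a block occupies nine levels, with [x], [y], [z], [b] all on the second,
    and adjacent vertices differ by at most one level.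

    Any two vertices of a sun, or of three consecutive path vertices, lie in a
    common closed neighbourhood, so a multipacking meets each such piece at most
    once: this gives at most [9k], attained by one vertex on every third level.
    For the broadcast number, put weight 2/3 on [b], 1/3 on [a], [c] and the path
    vertices, and 0 on [x], [y], [z].  Each ball of radius [r >= 1] has weight at
    most [r], so the total weight [10k] bounds the cost from below.  Conversely
    27 levels are tiled at cost 10 by three balls of radius 2, centred at [c], [z]
    and [a] of the successive suns, and four balls of radius 1 on the paths. *)

(** * Balls, elimination orders and weight bounds in arbitrary graphs *)

Lemma cballP (G : sgraph) (r : nat) (v u : G) :
  reflect (exists p, [/\ path (@adj G) u p, last u p = v & size p <= r])
          (u \in cball r v).
Proof.
rewrite inE /dist; set a := fun n : nat => walk_of_length n u v.
apply: (iffP andP) => [[/connectP[p up v_last] le_r] | [p [up last_v le_r]]].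
  have a_found : has a (iota 0 #|G|).
    case: (shortenP up) v_last => p' up' uniq_p' _ v_last.
    apply/hasP; exists (size p').
      by rewrite mem_iota /= -[(size p').+1]/(size (u :: p')) -(card_uniqP uniq_p') max_card.
    by apply/existsP; exists (in_tuple p'); rewrite /= up' v_last eqxx.
  have := nth_find 0 a_found.
  rewrite nth_iota -?has_find ?add0n //; last first.
    by move: a_found; rewrite has_find size_iota.
  case/existsP=> t /andP[ut /eqP last_t].
  by exists t; rewrite size_tuple.
split; first by apply/connectP; exists p.
apply: leq_trans le_r; have [lt_p | le_p] := ltnP (size p) #|G|; last first.
  by rewrite (leq_trans (find_size _ _)) // size_iota.
rewrite leqNgt; apply/negP=> /(before_find 0); rewrite nth_iota // add0n.
by case/existsP; exists (in_tuple p); rewrite /= up last_v eqxx.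
Qed.

Lemma cball_lipschitz (G : sgraph) (h : G -> nat) :
    (forall u v : G, adj u v -> h u <= (h v).+1) ->
  forall (r : nat) (u v : G),
    u \in cball r v -> h u <= h v + r /\ h v <= h u + r.
Proof.
move=> h_adj r u v /cballP[p [up <- {v}]].
elim: p u r up => [|w p IHp] u r /=; first by move=> _ _; lia.
case/andP=> uw wp; case: r => // r /(IHp w r wp).
have := h_adj _ _ uw; have : adj w u by rewrite adj_sym.
by move/h_adj; lia.
Qed.

(** On a cycle, a vertex [v] of maximal rank has both its cycle neighbours ranked no higher, hence
    adjacent; on four or more vertices they are not consecutive. *)
Lemma chordal_of_elimination_order (G : sgraph) (rank : G -> nat) :
    (forall v u w : G, adj v u -> adj v w -> rank u <= rank v ->
       rank w <= rank v -> u != w -> adj u w) ->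
  chordal G.
Proof.
move=> elimG c cyc_c size_c.
have [x0 x0_c] : exists x0, x0 \in c.
  by case: c size_c {cyc_c} => // x c _; exists x; rewrite mem_head.
case: (@arg_maxnP _ x0 (mem c) rank x0_c) => v v_c max_v.
have [i s def_c] := rot_to v_c.
have uniq_c : uniq c by case/andP: cyc_c.
have cyc_s : ucycle (@adj G) (v :: s) by rewrite -def_c rot_ucycle.
have size_s : size (v :: s) = size c by rewrite -def_c size_rot.
have c_s x : x \in v :: s -> x \in c by rewrite -def_c mem_rot.
have next_s x : next c x = next (v :: s) x by rewrite -def_c next_rot.
case: s => [|a [|b s]] in def_c cyc_s size_s c_s next_s;
  try by move: size_c; rewrite -size_s.
case/lastP: s => [|s d] in def_c cyc_s size_s c_s next_s.
  by move: size_c; rewrite -size_s.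
case/andP: cyc_s => path_s uniq_s.
have d_s : d \in [:: v, a, b & rcons s d] by rewrite !inE mem_rcons mem_head !orbT.
have a_s : a \in [:: v, a, b & rcons s d] by rewrite !inE eqxx orbT.
have adj_va : adj v a by case/andP: path_s.
have adj_vd : adj v d.
  move: path_s => /= /and3P[_ _]; rewrite rcons_path last_rcons.
  by case/andP=> _; rewrite adj_sym.
move: (uniq_s) => /=; rewrite !inE !mem_rcons !inE !negb_or.
case/and4P=> /and4P[va vb vd _] /and3P[ab ad _] /andP[bd _] _.
exists a, d; split; rewrite ?next_s.
- exact: c_s.
- exact: c_s.
- by apply: (elimG v) => //; apply: max_v; apply: c_s.
- by rewrite /= [a == v]eq_sym (negPf va) eqxx eq_sym.
(* The successor of [v] is also [a], so injectivity of [next] would force [v = d]. *)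
apply: contraNneq vd => a_next; apply/eqP.
apply: (can_inj (prev_next uniq_s)); rewrite -a_next /=.
by rewrite eqxx.
Qed.

(** Weak linear programming duality, scaled by [d] to keep weights integral: domination puts every
    vertex in some broadcast ball, so summing weights ball by ball counts each vertex at least
    once. *)
Lemma broadcast_cost_ge (G : sgraph) (W : G -> nat) (f : broadcast G) (d : nat) :
    (forall (v : G) (r : nat), 0 < r -> \sum_(u in cball r v) W u <= d * r) ->
  dominating f -> \sum_u W u <= d * cost f.
Proof.
move=> packW dom_f.
rewrite /cost big_distrr /=.
apply: (@leq_trans (\sum_v \sum_(u | (0 < f v) && (u \in cball (f v) v)) W u)).
  rewrite (exchange_big_dep predT) //=; apply: leq_sum => u _.
  have [v [fv uv]] := dom_f u.
  by rewrite (bigD1 v) ?fv //= leq_addr.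
apply: leq_sum => v _; have [-> | fv] := posnP (f v); first by rewrite big_pred0.
exact: packW.
Qed.

(** Bounds sums over balls by sums over explicit lists; repetitions and entries beyond [N] only
    enlarge the right side. *)
Lemma sum_ord_le_seq (N : nat) (P : pred 'I_N) (W : nat -> nat) (s : seq nat) :
    (forall n : 'I_N, P n -> 0 < W n -> val n \in s) ->
  \sum_(n < N | P n) W n <= \sum_(n <- s) W n.
Proof.
move=> P_s.
apply: (@leq_trans (\sum_(n <- s) \sum_(j < N | P j && (val j == n)) W j)).
  rewrite (exchange_big_dep P) //=; last by move=> n j _ /andP[].
  apply: leq_sum => j Pj; have [-> // | Wj] := posnP (W j).
  by rewrite (big_rem (val j)) ?P_s //= Pj eqxx leq_addr.
apply: leq_sum => n _; have [lt_n | le_n] := ltnP n N; last first.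
  rewrite big_pred0 // => j; apply/negP=> /andP[_ /eqP def_n].
  by move: le_n; rewrite -def_n leqNgt ltn_ord.
by rewrite (eq_bigl (fun j => P j && (j == Ordinal lt_n))) //= big_mkcondl /= big_pred1_eq; case: ifP.
Qed.

Lemma sum_periodic (p m : nat) (F : nat -> nat) :
    (forall q i, i < p -> F (q * p + i) = F i) ->
  \sum_(n < m * p) F n = m * \sum_(i <- iota 0 p) F i.
Proof.
move=> perF; rewrite -[p in iota 0 p]subn0 -/(index_iota 0 p) -(big_mkord xpredT).
elim: m => [|m IHm]; first by rewrite mul0n big_geq.
rewrite mulSn addnC (@big_cat_nat _ _ _ (m * p)) ?leq_addr //= IHm.
rewrite -{1}[m * p]add0n big_addn addKn mulSn addnC; congr addn.
by apply: eq_big_nat => i /andP[_ lt_i]; rewrite addnC perF.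
Qed.

Lemma cball_trans (G : sgraph) (r s : nat) (u v w : G) :
  u \in cball r v -> v \in cball s w -> u \in cball (r + s) w.
Proof.
case/cballP=> p [up v_last le_r] /cballP[q [vq w_last le_s]].
apply/cballP; exists (p ++ q).
by rewrite cat_path last_cat v_last up vq size_cat leq_add.
Qed.

Lemma cball1E (G : sgraph) (u v : G) :
  (u \in cball 1 v) = (u == v) || adj u v.
Proof.
apply/cballP/orP => [[[|w [|w' p]] [//= up last_v _]] | [/eqP-> | uv]].
- by left; apply/eqP.
- by right; rewrite -last_v; case/andP: up.
- by exists [::].
by exists [:: v]; rewrite /= uv.
Qed.

(** * Finite checks by computation and the periodic adjacency of the chain *)

Lemma iota_allP (n : nat) (P : pred nat) :
  all P (iota 0 n) -> forall i, i < n -> P i.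
Proof. by move=> /allP allP i lt_i; apply: allP; rewrite mem_iota. Qed.

(* Vertices are natural numbers: the residues 0, ..., 5 modulo 12 are
   a, z, x, y, b, c and the residues 6, ..., 11 are the path.  The neighbours of
   [m] smaller than [m] are the [m - d] with [d] in [back_steps (m %% 12)]; this
   order is a perfect elimination order. *)
Definition back_steps (i : nat) : seq nat :=
  nth [:: 1] [:: [:: 1]; [:: 1]; [:: 1; 2]; [:: 1; 2]; [:: 1; 2]; [:: 2; 4]] i.

(** For [m <= n] the truncated difference is 0, which is never a step. *)
Definition back (m n : nat) : bool := m - n \in back_steps (m %% 12).

Definition chain_adj (m n : nat) : bool := back m n || back n m.

Definition level (n : nat) : nat :=
  n %/ 12 * 9 + nth 0 [:: 0; 1; 1; 1; 1; 2; 3; 4; 5; 6; 7; 8] (n %% 12).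

(* Three times the fractional weight. *)
Definition weight (n : nat) : nat :=
  nth 0 [:: 1; 0; 0; 0; 2; 1; 1; 1; 1; 1; 1; 1] (n %% 12).

(* The only vertex of nonzero weight on level [l]. *)
Definition level_rep (l : nat) : nat :=
  l %/ 9 * 12 + nth 0 [:: 0; 4; 5; 6; 7; 8; 9; 10; 11] (l %% 9).

(** Residues 5, 13, 24 are the [c], [z], [a] of three successive suns; 9, 20, 31, 34 lie on the
    paths. *)
Definition radius (n : nat) : nat :=
  let i := n %% 36 in
  if i \in [:: 5; 13; 24] then 2 else if i \in [:: 9; 20; 31; 34] then 1 else 0.

Definition close (m n : nat) : bool := (m == n) || chain_adj m n.

Lemma chain_adj_sym : symmetric chain_adj.
Proof. by move=> m n; rewrite /chain_adj orbC. Qed.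

Lemma back_bounds m n : back m n -> n < m <= n + 4.
Proof.
rewrite /back; move: (m %% 12) => i.
by do 6?[case: i => [|i]]; rewrite /back_steps /= ?nth_nil !inE; lia.
Qed.

Lemma chain_adj_irr : irreflexive chain_adj.
Proof. by move=> n; apply/negP; case/orP=> /back_bounds; lia. Qed.

Lemma chain_adj_shift q i j :
  chain_adj (q * 12 + i) (q * 12 + j) = chain_adj i j.
Proof. by rewrite /chain_adj /back !subnDl !modnMDl. Qed.

Lemma close_shift q i j : close (q * 12 + i) (q * 12 + j) = close i j.
Proof. by rewrite /close eqn_add2l chain_adj_shift. Qed.

Lemma close_bounds m n : close m n -> m <= n + 4 /\ n <= m + 4.
Proof. by case/orP=> [/eqP-> | /orP[] /back_bounds]; lia. Qed.

Lemma level_shift q i : level (q * 12 + i) = q * 9 + level i.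
Proof. by rewrite /level divnMDl // modnMDl mulnDl addnA. Qed.

Lemma weight_shift q i : weight (q * 12 + i) = weight i.
Proof. by rewrite /weight modnMDl. Qed.

(* Since adjacent numbers differ by at most 4, adjacency questions about [n]
   reduce, after a shift by a multiple of 12, to finitely many ones. *)
Lemma block_frame n :
  exists q i, [/\ n = q * 12 + i, i < 24 &
    forall m, m <= n + 4 -> n <= m + 4 -> exists2 j, m = q * 12 + j & j < 36].
Proof.
(* The frame starts one block early, when there is one, to leave room for the smaller neighbours. *)
exists (n %/ 12).-1, (n - (n %/ 12).-1 * 12); split; [lia | lia |].
by move=> m le_m ge_m; exists (m - (n %/ 12).-1 * 12); lia.
Qed.

Lemma level_adj m n : chain_adj m n -> level m <= (level n).+1.
Proof.
move=> mn; have [] := @close_bounds m n; first by rewrite /close mn orbT.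
have [q [i [def_n lt_i frameP]]] := block_frame n.
move=> le_m le_n; have [j def_m lt_j] := frameP m le_m le_n.
rewrite {}def_m {}def_n {m n frameP le_m le_n} in mn *.
rewrite chain_adj_shift in mn; rewrite !level_shift.
suffices: level j <= (level i).+1 by lia.
move: mn; apply/implyP; move: j lt_j; apply: iota_allP; move: i lt_i.
by apply: iota_allP; vm_compute.
Qed.

Lemma elimination_clique n m1 m2 :
  back n m1 -> back n m2 -> m1 != m2 -> chain_adj m1 m2.
Proof.
have [q [i [-> lt_i frameP]]] := block_frame n.
move=> nm1 nm2; have := back_bounds _ _ nm1; have := back_bounds _ _ nm2.
move=> b2 b1; have [||j1 def_m1 lt_j1] := frameP m1; [lia | lia |].
have [||j2 def_m2 lt_j2] := frameP m2; [lia | lia |].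
rewrite {}def_m1 {}def_m2 {m1 m2 b1 b2 frameP} in nm1 nm2 *.
rewrite chain_adj_shift eqn_add2l.
move: nm1 nm2; rewrite /back !subnDl !modnMDl -![_ \in _]/(back _ _).
suffices: [&& back i j1, back i j2 & j1 != j2] ==> chain_adj j1 j2.
  by move=> /implyP H H1 H2 H3; apply: H; apply/and3P.
move: j2 lt_j2; apply: iota_allP; move: j1 lt_j1; apply: iota_allP.
by move: i lt_i; apply: iota_allP; vm_compute.
Qed.

(** Connectedness follows by descent to vertex 0. *)
Lemma back_ex n : 0 < n -> exists m, back n m.
Proof.
have [q [i [-> lt_i _]]] := block_frame n => n_gt0.
have [i0 | i_gt0] := posnP i.
  (* Here the neighbour is the last path vertex of the preceding block, outside the frame. *)
  exists (q * 12 + i).-1; rewrite /back i0 addn0 modnMl /back_steps inE; lia.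
have : has (back i) (iota 0 24).
  move: i_gt0; apply/implyP; move: i lt_i {n_gt0}.
  by apply: iota_allP; vm_compute.
by case/hasP=> j _ ij; exists (q * 12 + j); rewrite /back subnDl modnMDl.
Qed.

(** * The finite chain: connectedness and chordality *)

Definition chain_graph (N : nat) : sgraph :=
  @SGraph 'I_N (fun u v => chain_adj u v)
    (fun u v => chain_adj_sym u v) (fun u => chain_adj_irr u).

Lemma chain_connected N : 0 < N -> connected (chain_graph N).
Proof.
move=> N_gt0; split; first by rewrite card_ord.
have sym : connect_sym (@adj (chain_graph N)).
  by apply: sym_connect_sym; apply: adj_sym.
suffices to0 (u : chain_graph N) : connect (@adj (chain_graph N)) (Ordinal N_gt0) u.
  by move=> u v; apply: connect_trans (to0 v); rewrite sym.
case: u => n; have [m le_nm] := ubnP n; elim: m n le_nm => // m IHm n le_nm lt_n.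
have [n0 | n_gt0] := posnP n; first by subst n; apply/eq_connect0/val_inj.
have [n' nn'] := back_ex _ n_gt0; have /andP[lt_n' _] := back_bounds _ _ nn'.
have lt_n'N : n' < N := ltn_trans lt_n' lt_n.
apply: connect_trans (IHm n' (leq_trans lt_n' le_nm) lt_n'N) _.
by apply: connect1; rewrite /= /chain_adj nn' orbT.
Qed.

Lemma chain_chordal N : chordal (chain_graph N).
Proof.
apply: (chordal_of_elimination_order _ (fun u : chain_graph N => val u)).
move=> v u w vu vw le_u le_w ne_uw; apply: (@elimination_clique v) => //.
  by case/orP: vu => // /back_bounds; rewrite ltnNge le_u.
by case/orP: vw => // /back_bounds; rewrite ltnNge le_w.
Qed.

Lemma chain_level N (u v : chain_graph N) r :
  u \in cball r v -> level u <= level v + r /\ level v <= level u + r.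
Proof.
apply: (cball_lipschitz _ (fun u : chain_graph N => level u)).
by move=> u' v'; apply: level_adj.
Qed.

Lemma cball1_chain N (u v : chain_graph N) : (u \in cball 1 v) = close u v.
Proof. by rewrite cball1E. Qed.

(** * Fractional weights: the lower bound for broadcasts *)

Lemma weight_rep n : 0 < weight n -> n = level_rep (level n).
Proof.
rewrite (divn_eq n 12) weight_shift level_shift /level_rep divnMDl // modnMDl.
rewrite mulnDl -addnA => n_gt0; congr (_ + _); apply/eqP; move: n_gt0.
apply/implyP; move: (_ %% _) (@ltn_pmod n 12 isT).
by apply: iota_allP; vm_compute.
Qed.

(* [l + (l + 7) %/ 9] is the total weight of the levels below [l]. *)
Lemma weight_level_rep l :
  weight (level_rep l) + (l + (l + 7) %/ 9) = l.+1 + (l.+1 + 7) %/ 9.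
Proof.
rewrite /level_rep weight_shift.
pose w i := weight (nth 0 [:: 0; 4; 5; 6; 7; 8; 9; 10; 11] i).
 rewrite -[weight _]/(w (l %% 9)).
suffices: w (l %% 9) + (l %% 9 + 7) %/ 9 == ((l %% 9).+1 + 7) %/ 9 + 1 by lia.
by move: (l %% 9) (@ltn_pmod l 9 isT); apply: iota_allP; vm_compute.
Qed.

Lemma sum_weight_level_rep l m :
  \sum_(i <- iota l m) weight (level_rep i) + (l + (l + 7) %/ 9)
  = l + m + (l + m + 7) %/ 9.
Proof.
elim: m => [|m IHm]; first by rewrite big_nil !addn0.
rewrite -addn1 iotaD big_cat big_seq1 /=.
by have := weight_level_rep (l + m); lia.
Qed.

(** For [r >= 2] the ball lies in 2r + 1 consecutive levels; one level in nine weighs 2 and the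
    others 1, so the weight is at most 2r + 1 + ceil((2r + 1)/9) <= 3r. For [r = 1] this count can
    reach 4, so closed neighbourhoods are checked directly: none contains all three ears of a
    sun. *)
Lemma weight_packing N (v : chain_graph N) r :
  0 < r -> \sum_(u in cball r v) weight u <= 3 * r.
Proof.
case: r => [|[_|r _]] //.
  have [q [i [def_v lt_i frameP]]] := block_frame v.
  pose s := [seq j <- iota 0 36 | close j i].
  apply: leq_trans (sum_ord_le_seq _ _ weight [seq q * 12 + j | j <- s] _) _.
    move=> n; rewrite cball1_chain => nv _; have [le_n le_v] := close_bounds _ _ nv.
    have [j def_n lt_j] := frameP n le_n le_v.
    rewrite [val n]def_n; apply: map_f; rewrite mem_filter mem_iota lt_j.
    by rewrite -(close_shift q) -def_n -def_v nv.
  rewrite big_map (eq_bigr weight) => [|j _]; last exact: weight_shift.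
  rewrite /s unlock; move: i lt_i {def_v s frameP}.
  by apply: iota_allP; vm_compute.
(* Truncation at the start of the chain only shortens the window. *)
pose lo := level v - r.+2; pose m := (level v + r.+2).+1 - lo.
apply: leq_trans (sum_ord_le_seq _ _ weight (map level_rep (iota lo m)) _) _.
  move=> n /chain_level lev_n /weight_rep def_n.
  rewrite [val n]def_n; apply: map_f.
  by rewrite mem_iota; lia.
rewrite big_map; have := sum_weight_level_rep lo m.
by have : m <= r.+2.*2.+1; lia.
Qed.

Lemma sum_weight k : \sum_(u < k * 36) weight u = 3 * (10 * k).
Proof.
rewrite -[36]/(3 * 12) mulnA sum_periodic => [|q i _]; last exact: weight_shift.
have -> : \sum_(i <- iota 0 12) weight i = 10 by rewrite unlock.
by lia.
Qed.

Lemma chain_broadcast_ge k (f : broadcast (chain_graph (k * 36))) :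
  dominating f -> 10 * k <= cost f.
Proof.
move=> dom_f; rewrite -(leq_pmul2l (isT : 0 < 3)) -sum_weight.
exact: (broadcast_cost_ge _ _ _ _ (@weight_packing _)).
Qed.

(** * A dominating broadcast of cost 10k *)

Lemma diam_ge (G : sgraph) (u v : G) : dist u v <= diam G.
Proof.
apply: leq_trans (leq_bigmax u).
exact: (@leq_bigmax _ (fun v => dist u v)).
Qed.

(** Makes the value 2 admissible in a broadcast; the witnesses are the ears [a] and [c] of the first
    sun, two levels apart. *)
Lemma diam_chain_ge2 N : 36 <= N -> 2 <= diam (chain_graph N).
Proof.
move=> N_ge; have N_gt0 : 0 < N by lia.
have [lt0 lt5] : 0 < N /\ 5 < N by lia.
pose u : chain_graph N := Ordinal lt0; pose v : chain_graph N := Ordinal lt5.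
apply: leq_trans (diam_ge _ u v).
have uv : u \in cball (dist u v) v.
  by rewrite inE leqnn andbT; apply: (chain_connected _ N_gt0).2.
by have [_] := chain_level _ _ _ _ uv.
Qed.

Lemma radius_shift q i : radius (q * 36 + i) = radius i.
Proof. by rewrite /radius modnMDl. Qed.

Lemma radius_le2 n : radius n <= 2.
Proof. by rewrite /radius; do 2?case: ifP. Qed.

Lemma chain_broadcast_ex k : 0 < k ->
  exists f : broadcast (chain_graph (k * 36)), dominating f /\ cost f = 10 * k.
Proof.
move=> k_gt0; set G := chain_graph _.
have N_ge : 36 <= k * 36 by lia.
pose f : broadcast G := [ffun v => inord (radius (val v))].
have fE v : f v = radius v :> nat.
  by rewrite ffunE inordK // ltnS (leq_trans (radius_le2 _)) ?diam_chain_ge2.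
exists f; split; last first.
  rewrite /cost (eq_bigr (fun v : 'I__ => radius v)) => [|v _]; last exact: fE.
  rewrite sum_periodic => [|q i _]; last exact: radius_shift.
  have -> : \sum_(i <- iota 0 36) radius i = 10 by rewrite unlock.
  by rewrite mulnC.
move=> u; pose q := u %/ 36.
have ltN i : i < 36 -> q * 36 + i < k * 36.
  by have := ltn_ord u; rewrite /q; lia.
have def_u : val u = q * 36 + u %% 36 by apply: divn_eq.
have closeE i j : close (q * 36 + i) (q * 36 + j) = close i j.
  by rewrite -[36]/(3 * 12) mulnA close_shift.
(* Each vertex is dominated from within its own period of 36, along a walk staying there, so the
   ends of the chain need no special treatment. *)
have : has (fun j => ((0 < radius j) && close (u %% 36) j) ||
    (radius j == 2) && has (fun w => close (u %% 36) w && close w j) (iota 0 36))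
  (iota 0 36).
  by move: (u %% 36) (@ltn_pmod u 36 isT); apply: iota_allP; vm_compute.
case/hasP=> j; rewrite mem_iota => /andP[_ lt_j] dom_j.
exists (Ordinal (ltN j lt_j) : G); rewrite fE /= radius_shift.
case/orP: dom_j => [/andP[radius_j uj] | /andP[/eqP-> /hasP[w]]].
  split=> //; have : u \in cball 1 (Ordinal (ltN j lt_j) : G).
    by rewrite cball1_chain /= [nat_of_ord u]def_u closeE.
  by rewrite !inE => /andP[-> /leq_trans->].
rewrite mem_iota /= => lt_w /andP[uw wj]; split=> //.
apply: (@cball_trans _ 1 1 _ (Ordinal (ltN w lt_w) : G)).
  by rewrite cball1_chain /= [nat_of_ord u]def_u closeE.
by rewrite cball1_chain /= closeE.
Qed.

(** * Multipackings of the chain *)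

Lemma level_div9 n : level n %/ 9 = n %/ 12.
Proof.
rewrite /level divnMDl // [X in _ + X]divn_small ?addn0 //.
by move: (_ %% _) (@ltn_pmod n 12 isT); apply: iota_allP; vm_compute.
Qed.

(** Three levels form a sun or three consecutive path vertices. Keeping [w] in the same block
    ensures that it is a vertex of the finite chain. *)
Lemma common_close m n : level m %/ 3 = level n %/ 3 ->
  exists w, [/\ w %/ 12 = n %/ 12, close m w & close n w].
Proof.
move=> eq_mn; have eq_q : m %/ 12 = n %/ 12.
  by rewrite -!level_div9 -[9]/(3 * 3) !divnMA eq_mn.
move: eq_mn; rewrite (divn_eq m 12) (divn_eq n 12) eq_q !level_shift.
set q := n %/ 12 => eq_ij.
have : has (fun w => close (m %% 12) w && close (n %% 12) w) (iota 0 12).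
  have : level (m %% 12) %/ 3 == level (n %% 12) %/ 3.
    by apply/eqP; move: eq_ij; rewrite -[9]/(3 * 3) mulnA !divnMDl //; lia.
  apply/implyP; move: (m %% 12) (@ltn_pmod m 12 isT); apply: iota_allP.
  by move: (n %% 12) (@ltn_pmod n 12 isT); apply: iota_allP; vm_compute.
case/hasP=> w; rewrite mem_iota /= => lt_w /andP[mw nw].
exists (q * 12 + w); split; rewrite ?close_shift //.
by rewrite !divnMDl // !divn_small // ltn_mod.
Qed.

Lemma chain_multipacking_le k (M : {set chain_graph (k * 36)}) :
  multipacking M -> #|M| <= 9 * k.
Proof.
move=> packM; have lt_piece (u : chain_graph (k * 36)) : level u %/ 3 < 9 * k.
  by have := level_div9 u; have := ltn_ord u; lia.
pose piece u := Ordinal (lt_piece u).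
rewrite -[9 * k]card_ord -(@card_in_imset _ _ piece) ?max_card // => u v Mu Mv.
move/(congr1 val)/common_close=> [w [eq_w uw vw]].
have lt_w : w < k * 36 by have := ltn_ord v; lia.
apply/eqP; apply: contraTT (packM (Ordinal lt_w) 1 isT) => ne_uv.
rewrite -ltnNge; apply: (@leq_trans #|[set u; v]|); first by rewrite cards2 ne_uv.
apply: subset_leq_card; apply/subsetP.
by move=> x; rewrite in_setI cball1_chain !inE => /orP[] /eqP->; rewrite ?uw ?vw.
Qed.

(** Selects residues 0, 6, 9 modulo 12; positive weight lets [weight_rep] recover the vertex from
    its level. *)
Definition third (n : nat) : nat := (3 %| level n) && (0 < weight n).

Lemma third_shift q i : third (q * 12 + i) = third i.
Proof.
by rewrite /third level_shift weight_shift dvdn_addr // dvdn_mull.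
Qed.

Lemma third_rep n : 0 < third n -> n = level_rep (3 * (level n %/ 3)).
Proof.
rewrite /third lt0b => /andP[/divnK].
by rewrite mulnC => -> /weight_rep.
Qed.

Lemma chain_multipacking_ex k :
  exists M : {set chain_graph (k * 36)}, multipacking M /\ #|M| = 9 * k.
Proof.
exists [set u | 0 < third (val u)]; split; last first.
  rewrite -sum1_card big_mkcond /= (eq_bigr (fun u : 'I__ => third u)).
    rewrite -[36]/(3 * 12) mulnA sum_periodic => [|q i _]; last exact: third_shift.
    have -> : \sum_(i <- iota 0 12) third i = 3 by rewrite unlock.
    by lia.
  by move=> u _; rewrite inE /third; case: (_ && _).
move=> v r r_gt0; set B := _ :&: _.
have -> : #|B| = \sum_(u in B) third u.
  rewrite -sum1_card; apply: eq_bigr => u; rewrite !inE /third => /andP[_].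
  by case: (_ && _).
(* A ceiling: the least [t] with 3t >= level v - r. As [r >= 1], 3(lo + r) exceeds level v + r, so
   [r] values of [t] suffice. *)
pose lo := (level v - r + 2) %/ 3.
apply: leq_trans
  (sum_ord_le_seq _ _ third [seq level_rep (3 * t) | t <- iota lo r] _) _.
  move=> n; rewrite in_setI => /andP[/chain_level lev_n _] /[dup] /third_rep def_n.
  rewrite /third lt0b => /andP[dvd_n _].
  rewrite [val n]def_n; apply: (map_f (fun t => level_rep (3 * t))).
  by rewrite mem_iota; lia.
rewrite big_map -[leqRHS](size_iota lo) -sum1_size.
by apply: leq_sum => t _; apply: leq_b1.
Qed.

Theorem theorem1 (k : nat) (hk : 0 < k) :
  exists H : sgraph,
    [/\ connected H, chordal H,
        is_multipacking_number H (9 * k) & is_broadcast_number H (10 * k)].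
Proof.
exists (chain_graph (k * 36)); split.
- by apply: chain_connected; rewrite muln_gt0 hk.
- exact: chain_chordal.
- by split; [apply: chain_multipacking_ex | apply: chain_multipacking_le].
by split; [apply: chain_broadcast_ex | apply: chain_broadcast_ge].
Qed.
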